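(* Let $\mathbb A$ be a distributive monoidal category. In the free cornering with iteration $\ulcorner\mathbb A\urcorner^{*}$, for all $U\in\mathbb A^{\circ\bullet}_*$ and $A,B\in\mathbb A_0$, the crossing cells satisfy $\chi_{U,A\oplus B}=\left[\frac{\chi_{U,A}}{\sigma_0},\frac{\chi_{U,B}}{\sigma_1}\right]$. That is, $\chi_{U,A\oplus B}$ is the unique cell such that $$\frac{\sigma_0}{\chi_{U,A\oplus B}}=\frac{\chi_{U,A}}{\sigma_0},\qquad \frac{\sigma_1}{\chi_{U,A\oplus B}}=\frac{\chi_{U,B}}{\sigma_1},$$ where $\sigma_0:A\to A\oplus B$, $\sigma_1:B\to A\oplus B$ are the coproduct injections.
   Context: Monoidal categories are strict, and composites are in diagrammatic order ($fg$ is first $f$, then $g$). $\sigma_{A,B}:A\otimes B\to B\otimes A$ (two object subscripts) is the braiding. A single-object double category $\mathbb D$ has a horizontal edge monoid $(\mathbb D_H,\otimes,I)$, a vertical edge monoid $(\mathbb D_V,\otimes,I)$, and for $A,B\in\mathbb D_H$, $U,W\in\mathbb D_V$ a set of cells $(U;A;B;W)$ (left; top; bottom; right boundary). For $\alpha:(U;A;B;V)$ and $\beta:(V;A';B';W)$ there is a horizontal composite $\alpha\mid\beta:(U;A\otimes A';B\otimes B';W)$; for $\alpha:(U;A;C;W)$ and $\beta:(U';C;B;W')$ a vertical composite $\frac{\alpha}{\beta}:(U\otimes U';A;B;W\otimes W')$. Both are associative and unital, with horizontal units $id_U:(U;I;I;U)$ and vertical units $1_A:(I;A;A;I)$, where $id_I=1_I$,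 $1_{A\otimes B}=1_A\mid 1_B$, $id_{U\otimes W}=\frac{id_U}{id_W}$, and interchange $\frac{\alpha}{\beta}\mid\frac{\gamma}{\delta}=\frac{\alpha\mid\gamma}{\beta\mid\delta}$ holds. A distributive monoidal category $(\mathbb A,\otimes,\oplus,I)$ is a symmetric monoidal category with binary coproducts $A\oplus B$ (injections $\sigma_0,\sigma_1$, copairing $[f,g]$; no initial object required) such that $[\sigma_0\otimes 1_C,\sigma_1\otimes 1_C]:(A\otimes C)\oplus(B\otimes C)\to(A\oplus B)\otimes C$ is invertible for all $A,B,C$. Exchanges with iteration: $\mathbb A^{\circ\bullet}_*$ is the monoid (operation $\otimes$, unit $I$) with elements generated by $A^\circ$, $A^\bullet$ ($A\in\mathbb A_0$), $I$, $U\otimes W$, $U\times W$, $U+W$, $U^\times$, $U^+$, subject to associativity and unitality of $\otimes$ and the equations $U^\times=I\times(U\otimes U^\times)$, $U^+=I+(U\otimes U^+)$. Free cornering with iteration: $\ulcorner\mathbb A\urcorner^{*}$ is the free single-object double category with horizontal edge monoid $(\mathbb A_0,\otimes,I)$, vertical edge monoid $\mathbb A^{\circ\bullet}_*$, and generating cells and equations: (1) for each $f:A\to B$ in $\mathbb A$ a cell $\ulcorner f\urcorner:(I;A;B;I)$ (also written $f$), with $\ulcorner fg\urcorner=\frac{\ulcorner f\urcorner}{\ulcorner g\urcorner}$, $\ulcorner 1_A\urcorner=1_A$, $\ulcorner f\otimes g\urcorner=\ulcorner f\urcorner\mid\ulcorner g\urcorner$; (2) for each $A\in\mathbb A_0$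 corner cells $\mathsf{get}_L^A:(A^\circ;I;A;I)$, $\mathsf{put}_R^A:(I;A;I;A^\circ)$, $\mathsf{get}_R^A:(I;I;A;A^\bullet)$, $\mathsf{put}_L^A:(A^\bullet;A;I;I)$ with $\mathsf{put}_R^A\mid\mathsf{get}_L^A=1_A$, $\frac{\mathsf{get}_L^A}{\mathsf{put}_R^A}=id_{A^\circ}$, $\mathsf{get}_R^A\mid\mathsf{put}_L^A=1_A$, $\frac{\mathsf{get}_R^A}{\mathsf{put}_L^A}=id_{A^\bullet}$; (3) for all $U,W$, cells $\pi_0:(U\times W;I;I;U)$, $\pi_1:(U\times W;I;I;W)$, and for $\alpha:(V;A;B;U)$, $\beta:(V;A;B;W)$ a unique cell $\alpha\times\beta:(V;A;B;U\times W)$ with $(\alpha\times\beta)\mid\pi_0=\alpha$, $(\alpha\times\beta)\mid\pi_1=\beta$; (4) for all $U,W$, cells $\iota_0:(U;I;I;U+W)$, $\iota_1:(W;I;I;U+W)$, and for $\alpha:(U;A;B;V)$, $\beta:(W;A;B;V)$ a unique cell $\alpha+\beta:(U+W;A;B;V)$ with $\iota_0\mid(\alpha+\beta)=\alpha$, $\iota_1\mid(\alpha+\beta)=\beta$; (5) for $\alpha:(U;A;C;W)$, $\beta:(U;B;C;W)$ a unique cell $[\alpha,\beta]:(U;A\oplus B;C;W)$ with $\frac{\ulcorner\sigma_0\urcorner}{[\alpha,\beta]}=\alpha$, $\frac{\ulcorner\sigma_1\urcorner}{[\alpha,\beta]}=\beta$; (6) for $\alpha:(V;A;A;U)$, $f:(W;A;B;K)$,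 $g:(W;I;I;V\otimes W)$ a unique cell $\alpha^\times_{f,g}:(W;A;B;U^\times\otimes K)$ with $\alpha^\times_{f,g}\mid\frac{\pi_0}{id_K}=f$ and $\alpha^\times_{f,g}\mid\frac{\pi_1}{id_K}=g\mid\frac{\alpha}{\alpha^\times_{f,g}}$; (7) for $\alpha:(U;A;A;V)$, $f:(K;A;B;W)$, $g:(V\otimes W;I;I;W)$ a unique cell $\alpha^+_{f,g}:(U^+\otimes K;A;B;W)$ with $\frac{\iota_0}{id_K}\mid\alpha^+_{f,g}=f$ and $\frac{\iota_1}{id_K}\mid\alpha^+_{f,g}=\frac{\alpha}{\alpha^+_{f,g}}\mid g$. Here $\pi_0:U^\times\to I$, $\pi_1:U^\times\to U\otimes U^\times$, $\iota_0:I\to U^+$, $\iota_1:U\otimes U^+\to U^+$ are the projections/injections of $U^\times=I\times(U\otimes U^\times)$ and $U^+=I+(U\otimes U^+)$. For $\alpha:(U;A;A;W)$ put $\alpha^\times=\alpha^\times_{(\pi_0\mid 1_A),\pi_1}:(U^\times;A;A;W^\times)$ and $\alpha^+=\alpha^+_{(1_A\mid\iota_0),\iota_1}:(U^+;A;A;W^+)$. Crossing cells $\chi_{U,B}:(U;B;B;U)$, by induction on $U$: $\chi_{A^\circ,B}$ is the vertical composite (top to bottom) of $\mathsf{get}_L^A\mid 1_B$, $\sigma_{A,B}$, $1_B\mid\mathsf{put}_R^A$; $\chi_{A^\bullet,B}$ is the vertical composite (top to bottom) of $1_B\mid\mathsf{get}_R^A$, $\sigma_{B,A}$, $\mathsf{put}_L^A\mid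 1_B$; $\chi_{I,B}=1_B$; $\chi_{U\otimes W,B}=\frac{\chi_{U,B}}{\chi_{W,B}}$; $\chi_{U+W,B}=(\chi_{U,B}\mid\iota_0)+(\chi_{W,B}\mid\iota_1)$; $\chi_{U\times W,B}=(\pi_0\mid\chi_{U,B})\times(\pi_1\mid\chi_{W,B})$; $\chi_{U^\times,B}=(\chi_{U,B})^\times$; $\chi_{U^+,B}=(\chi_{U,B})^+$. *)

(* Defs.v *)
From mathcomp Require Import ssreflect ssrfun ssrbool.

Set Implicit Arguments.
Unset Strict Implicit.
Unset Printing Implicit Defensive.

Record category := Category {
  ob :> Type;
  hom : ob -> ob -> Type;
  idm : forall A, hom A A;
  (* diagrammatic order: [comp f g] is first [f], then [g] *)
  comp : forall A B C, hom A B -> hom B C -> hom A C;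
  comp1m : forall A B (f : hom A B), comp (idm A) f = f;
  compm1 : forall A B (f : hom A B), comp f (idm B) = f;
  compA : forall A B C D (f : hom A B) (g : hom B C) (h : hom C D),
    comp f (comp g h) = comp (comp f g) h }.

Arguments idm {_} A.

(* Strictness makes the endpoints of arrows equal only propositionally;
   [castm] transports an arrow along such equalities. *)
Definition castm (C : category) (A A' B B' : C) (eA : A = A') (eB : B = B')
    (f : hom A B) : hom A' B' :=
  match eA in _ = X, eB in _ = Y return hom X Y with
  | erefl, erefl => f
  end.

Record smcat := SMCat {
  smcat_cat :> category;
  un : smcat_cat;
  ten : smcat_cat -> smcat_cat -> smcat_cat;
  tenA : forall A B C, ten (ten A B) C = ten A (ten B C);
  ten1o : forall A, ten un A = A;
  teno1 : forall A, ten A un = A;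
  tenm : forall A A' B B' : smcat_cat,
    hom A A' -> hom B B' -> hom (ten A B) (ten A' B');
  tenm_id : forall A B : smcat_cat, tenm (idm A) (idm B) = idm (ten A B);
  tenm_comp : forall (A A' A'' B B' B'' : smcat_cat)
    (f : hom A A') (f' : hom A' A'') (g : hom B B') (g' : hom B' B''),
    tenm (comp f f') (comp g g') = comp (tenm f g) (tenm f' g');
  tenmA : forall (A A' B B' C C' : smcat_cat)
    (f : hom A A') (g : hom B B') (h : hom C C'),
    castm (tenA A B C) (tenA A' B' C') (tenm (tenm f g) h)
    = tenm f (tenm g h);
  tenm1o : forall (A A' : smcat_cat) (f : hom A A'),
    castm (ten1o A) (ten1o A') (tenm (idm un) f) = f;
  tenmo1 : forall (A A' : smcat_cat) (f : hom A A'),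
    castm (teno1 A) (teno1 A') (tenm f (idm un)) = f;
  braid : forall A B : smcat_cat, hom (ten A B) (ten B A);
  braid_nat : forall (A A' B B' : smcat_cat) (f : hom A A') (g : hom B B'),
    comp (tenm f g) (braid A' B') = comp (braid A B) (tenm g f);
  braidK : forall A B : smcat_cat,
    comp (braid A B) (braid B A) = idm (ten A B);
  braid_ten : forall A B C : smcat_cat,
    castm (esym (tenA A B C)) (tenA B C A) (braid A (ten B C))
    = comp (castm erefl (tenA B A C) (tenm (braid A B) (idm C)))
           (tenm (idm B) (braid A C)) }.

Arguments un {_}.

Record distmoncat := DistMonCat {
  distmoncat_smcat :> smcat;
  opl : distmoncat_smcat -> distmoncat_smcat -> distmoncat_smcat;
  sig0 : forall A B : distmoncat_smcat, hom A (opl A B);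
  sig1 : forall A B : distmoncat_smcat, hom B (opl A B);
  copm : forall A B C : distmoncat_smcat,
    hom A C -> hom B C -> hom (opl A B) C;
  sig0_copm : forall (A B C : distmoncat_smcat) (f : hom A C) (g : hom B C),
    comp (sig0 A B) (copm f g) = f;
  sig1_copm : forall (A B C : distmoncat_smcat) (f : hom A C) (g : hom B C),
    comp (sig1 A B) (copm f g) = g;
  copm_uniq : forall (A B C : distmoncat_smcat) (f : hom A C) (g : hom B C)
    (h : hom (opl A B) C),
    comp (sig0 A B) h = f -> comp (sig1 A B) h = g -> h = copm f g;
  distr : forall A B C : distmoncat_smcat,
    let d := copm (tenm (sig0 A B) (idm C)) (tenm (sig1 A B) (idm C)) in
    exists d' : hom (ten (opl A B) C) (opl (ten A C) (ten B C)),
      comp d d' = idm _ /\ comp d' d = idm _ }.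

(* The monoid of exchanges with iteration is the type [exch] of expressions
   modulo the congruence [=e]. *)
Inductive exch (O : Type) : Type :=
| eout of O             (* A° *)
| ein of O              (* A• *)
| eun
| eten of exch O & exch O
| eprod of exch O & exch O
| esum of exch O & exch O
| emul of exch O        (* U^× *)
| eplus of exch O.      (* U^+ *)

Arguments eun {O}.

Reserved Notation "U =e W" (at level 70, no associativity).

Inductive exch_eq (O : Type) : exch O -> exch O -> Prop :=
| ee_refl U : U =e U
| ee_sym U W : U =e W -> W =e U
| ee_trans U V W : U =e V -> V =e W -> U =e W
| ee_ten U U' W W' : U =e U' -> W =e W' -> eten U W =e eten U' W'
| ee_prod U U' W W' : U =e U' -> W =e W' -> eprod U W =e eprod U' W'
| ee_sum U U' W W' : U =e U' -> W =e W' -> esum U W =e esum U' W'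
| ee_mul U U' : U =e U' -> emul U =e emul U'
| ee_plus U U' : U =e U' -> eplus U =e eplus U'
| ee_tenA U V W : eten (eten U V) W =e eten U (eten V W)
| ee_ten1e U : eten eun U =e U
| ee_tene1 U : eten U eun =e U
| ee_mul_unfold U : emul U =e eprod eun (eten U (emul U))
| ee_plus_unfold U : eplus U =e esum eun (eten U (eplus U))
where "U =e W" := (exch_eq U W).

(* The free cornering with iteration, as a term model: its cells are the
   terms of [cell] modulo the congruence [=c].  The boundaries of a term are
   (left; top; bottom; right); since boundaries are elements of the two edge
   monoids, [conv] re-indexes a term along equalities of boundaries.  [=c]
   relates terms whose boundaries are equal in the edge monoids but possibly
   written differently (see [ceq_bound]), and it identifies [conv _ _ _ _ a] with
   [a]. *)

Section Cells.
Variable C : distmoncat.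
Implicit Types (U V W K : exch C) (A B : C).

Inductive cell : exch C -> C -> C -> exch C -> Type :=
| conv U U' A A' B B' W W' :
    U =e U' -> A = A' -> B = B' -> W =e W' ->
    cell U A B W -> cell U' A' B' W'
| hid U : cell U un un U                                  (* id_U *)
| vid A : cell eun A A eun                                (* 1_A *)
| hcomp U V W A A' B B' :                                 (* alpha | beta *)
    cell U A B V -> cell V A' B' W -> cell U (ten A A') (ten B B') W
| vcomp U U' W W' A B D :                                 (* alpha / beta *)
    cell U A D W -> cell U' D B W' -> cell (eten U U') A B (eten W W')
| crn A B : hom A B -> cell eun A B eun
| getL A : cell (eout A) un A eun
| putR A : cell eun A un (eout A)
| getR A : cell eun un A (ein A)
| putL A : cell (ein A) A un eun
| prj0 U W : cell (eprod U W) un un U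
| prj1 U W : cell (eprod U W) un un W
| pairc V U W A B :                                       (* alpha × beta *)
    cell V A B U -> cell V A B W -> cell V A B (eprod U W)
| inj0 U W : cell U un un (esum U W)
| inj1 U W : cell W un un (esum U W)
| casec U W V A B :                                       (* alpha + beta *)
    cell U A B V -> cell W A B V -> cell (esum U W) A B V
| copc U W A B D :                                        (* [alpha, beta] *)
    cell U A D W -> cell U B D W -> cell U (opl A B) D W
| itermul V U W K A B :                                   (* alpha^×_{f,g} *)
    cell V A A U -> cell W A B K -> cell W un un (eten V W) ->
    cell W A B (eten (emul U) K)
| iterplus U V K W A B :                                  (* alpha^+_{f,g} *)
    cell U A A V -> cell K A B W -> cell (eten V W) un un W ->
    cell (eten (eplus U) K) A B W.

Definition mprj0 U : cell (emul U) un un eun :=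
  conv (ee_sym (ee_mul_unfold U)) erefl erefl (ee_refl _)
    (prj0 eun (eten U (emul U))).
Definition mprj1 U : cell (emul U) un un (eten U (emul U)) :=
  conv (ee_sym (ee_mul_unfold U)) erefl erefl (ee_refl _)
    (prj1 eun (eten U (emul U))).
Definition pinj0 U : cell eun un un (eplus U) :=
  conv (ee_refl _) erefl erefl (ee_sym (ee_plus_unfold U))
    (inj0 eun (eten U (eplus U))).
Definition pinj1 U : cell (eten U (eplus U)) un un (eplus U) :=
  conv (ee_refl _) erefl erefl (ee_sym (ee_plus_unfold U))
    (inj1 eun (eten U (eplus U))).

Reserved Notation "a =c b" (at level 70, no associativity).

Inductive ceq : forall U A B W U' A' B' W',
    cell U A B W -> cell U' A' B' W' -> Prop :=
| ceq_refl U A B W (a : cell U A B W) : a =c a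
| ceq_sym U A B W U' A' B' W' (a : cell U A B W) (b : cell U' A' B' W') :
    a =c b -> b =c a
| ceq_trans U A B W U' A' B' W' U'' A'' B'' W'' (a : cell U A B W)
    (b : cell U' A' B' W') (c : cell U'' A'' B'' W'') :
    a =c b -> b =c c -> a =c c
| ceq_conv U U' A A' B B' W W' (eU : U =e U') (eA : A = A') (eB : B = B')
    (eW : W =e W') (a : cell U A B W) : conv eU eA eB eW a =c a
| ceq_hid U U' : U =e U' -> hid U =c hid U'
| ceq_hcomp U1 V1 W1 A1 A1' B1 B1' U2 V2 W2 A2 A2' B2 B2'
    (a1 : cell U1 A1 B1 V1) (b1 : cell V1 A1' B1' W1)
    (a2 : cell U2 A2 B2 V2) (b2 : cell V2 A2' B2' W2) :
    a1 =c a2 -> b1 =c b2 -> hcomp a1 b1 =c hcomp a2 b2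
| ceq_vcomp U1 U1' W1 W1' A1 B1 D1 U2 U2' W2 W2' A2 B2 D2
    (a1 : cell U1 A1 D1 W1) (b1 : cell U1' D1 B1 W1')
    (a2 : cell U2 A2 D2 W2) (b2 : cell U2' D2 B2 W2') :
    a1 =c a2 -> b1 =c b2 -> vcomp a1 b1 =c vcomp a2 b2
| ceq_prj0 U W U' W' : U =e U' -> W =e W' -> prj0 U W =c prj0 U' W'
| ceq_prj1 U W U' W' : U =e U' -> W =e W' -> prj1 U W =c prj1 U' W'
| ceq_pairc V1 U1 W1 A1 B1 V2 U2 W2 A2 B2
    (a1 : cell V1 A1 B1 U1) (b1 : cell V1 A1 B1 W1)
    (a2 : cell V2 A2 B2 U2) (b2 : cell V2 A2 B2 W2) :
    a1 =c a2 -> b1 =c b2 -> pairc a1 b1 =c pairc a2 b2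
| ceq_inj0 U W U' W' : U =e U' -> W =e W' -> inj0 U W =c inj0 U' W'
| ceq_inj1 U W U' W' : U =e U' -> W =e W' -> inj1 U W =c inj1 U' W'
| ceq_casec U1 W1 V1 A1 B1 U2 W2 V2 A2 B2
    (a1 : cell U1 A1 B1 V1) (b1 : cell W1 A1 B1 V1)
    (a2 : cell U2 A2 B2 V2) (b2 : cell W2 A2 B2 V2) :
    a1 =c a2 -> b1 =c b2 -> casec a1 b1 =c casec a2 b2
| ceq_copc U1 W1 A1 B1 D1 U2 W2 A2 B2 D2
    (a1 : cell U1 A1 D1 W1) (b1 : cell U1 B1 D1 W1)
    (a2 : cell U2 A2 D2 W2) (b2 : cell U2 B2 D2 W2) :
    a1 =c a2 -> b1 =c b2 -> copc a1 b1 =c copc a2 b2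
| ceq_itermul V1 U1 W1 K1 A1 B1 V2 U2 W2 K2 A2 B2
    (a1 : cell V1 A1 A1 U1) (f1 : cell W1 A1 B1 K1)
    (g1 : cell W1 un un (eten V1 W1))
    (a2 : cell V2 A2 A2 U2) (f2 : cell W2 A2 B2 K2)
    (g2 : cell W2 un un (eten V2 W2)) :
    a1 =c a2 -> f1 =c f2 -> g1 =c g2 ->
    itermul a1 f1 g1 =c itermul a2 f2 g2
| ceq_iterplus U1 V1 K1 W1 A1 B1 U2 V2 K2 W2 A2 B2
    (a1 : cell U1 A1 A1 V1) (f1 : cell K1 A1 B1 W1)
    (g1 : cell (eten V1 W1) un un W1)
    (a2 : cell U2 A2 A2 V2) (f2 : cell K2 A2 B2 W2)
    (g2 : cell (eten V2 W2) un un W2) :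
    a1 =c a2 -> f1 =c f2 -> g1 =c g2 ->
    iterplus a1 f1 g1 =c iterplus a2 f2 g2
| ceq_hcompA U V W X A B A' B' A'' B'' (a : cell U A B V)
    (b : cell V A' B' W) (c : cell W A'' B'' X) :
    hcomp (hcomp a b) c =c hcomp a (hcomp b c)
| ceq_hcomp1c U A B W (a : cell U A B W) : hcomp (hid U) a =c a
| ceq_hcompc1 U A B W (a : cell U A B W) : hcomp a (hid W) =c a
| ceq_vcompA U U' U'' W W' W'' A B D E (a : cell U A B W)
    (b : cell U' B D W') (c : cell U'' D E W'') :
    vcomp (vcomp a b) c =c vcomp a (vcomp b c)
| ceq_vcomp1c U A B W (a : cell U A B W) : vcomp (vid A) a =c a
| ceq_vcompc1 U A B W (a : cell U A B W) : vcomp a (vid B) =c a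
| ceq_hid_un : hid eun =c vid un
| ceq_vid_ten A B : vid (ten A B) =c hcomp (vid A) (vid B)
| ceq_hid_ten U W : hid (eten U W) =c vcomp (hid U) (hid W)
| ceq_interchange U V W U' V' W' A B D A' B' D'
    (a : cell U A D V) (b : cell U' D B V')
    (c : cell V A' D' W) (d : cell V' D' B' W') :
    hcomp (vcomp a b) (vcomp c d) =c vcomp (hcomp a c) (hcomp b d)
| ceq_crn_comp A B D (f : hom A B) (g : hom B D) :
    crn (comp f g) =c vcomp (crn f) (crn g)
| ceq_crn_id A : crn (idm A) =c vid A
| ceq_crn_ten A A' B B' (f : hom A A') (g : hom B B') :
    crn (tenm f g) =c hcomp (crn f) (crn g)
| ceq_putR_getL_h A : hcomp (putR A) (getL A) =c vid A
| ceq_getL_putR_v A : vcomp (getL A) (putR A) =c hid (eout A)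
| ceq_getR_putL_h A : hcomp (getR A) (putL A) =c vid A
| ceq_getR_putL_v A : vcomp (getR A) (putL A) =c hid (ein A)
| ceq_pairc0 V U W A B (a : cell V A B U) (b : cell V A B W) :
    hcomp (pairc a b) (prj0 U W) =c a
| ceq_pairc1 V U W A B (a : cell V A B U) (b : cell V A B W) :
    hcomp (pairc a b) (prj1 U W) =c b
| ceq_pairc_uniq V U W A B (a : cell V A B U) (b : cell V A B W)
    (h : cell V A B (eprod U W)) :
    hcomp h (prj0 U W) =c a -> hcomp h (prj1 U W) =c b -> h =c pairc a b
| ceq_casec0 U W V A B (a : cell U A B V) (b : cell W A B V) :
    hcomp (inj0 U W) (casec a b) =c a
| ceq_casec1 U W V A B (a : cell U A B V) (b : cell W A B V) :
    hcomp (inj1 U W) (casec a b) =c b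
| ceq_casec_uniq U W V A B (a : cell U A B V) (b : cell W A B V)
    (h : cell (esum U W) A B V) :
    hcomp (inj0 U W) h =c a -> hcomp (inj1 U W) h =c b -> h =c casec a b
| ceq_copc0 U W A B D (a : cell U A D W) (b : cell U B D W) :
    vcomp (crn (sig0 A B)) (copc a b) =c a
| ceq_copc1 U W A B D (a : cell U A D W) (b : cell U B D W) :
    vcomp (crn (sig1 A B)) (copc a b) =c b
| ceq_copc_uniq U W A B D (a : cell U A D W) (b : cell U B D W)
    (h : cell U (opl A B) D W) :
    vcomp (crn (sig0 A B)) h =c a -> vcomp (crn (sig1 A B)) h =c b ->
    h =c copc a b
| ceq_itermul0 V U W K A B (a : cell V A A U) (f : cell W A B K)
    (g : cell W un un (eten V W)) :
    hcomp (itermul a f g) (vcomp (mprj0 U) (hid K)) =c f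
| ceq_itermul1 V U W K A B (a : cell V A A U) (f : cell W A B K)
    (g : cell W un un (eten V W)) :
    hcomp (itermul a f g) (vcomp (mprj1 U) (hid K))
    =c hcomp g (vcomp a (itermul a f g))
| ceq_itermul_uniq V U W K A B (a : cell V A A U) (f : cell W A B K)
    (g : cell W un un (eten V W)) (h : cell W A B (eten (emul U) K)) :
    hcomp h (vcomp (mprj0 U) (hid K)) =c f ->
    hcomp h (vcomp (mprj1 U) (hid K)) =c hcomp g (vcomp a h) ->
    h =c itermul a f g
| ceq_iterplus0 U V K W A B (a : cell U A A V) (f : cell K A B W)
    (g : cell (eten V W) un un W) :
    hcomp (vcomp (pinj0 U) (hid K)) (iterplus a f g) =c f
| ceq_iterplus1 U V K W A B (a : cell U A A V) (f : cell K A B W)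
    (g : cell (eten V W) un un W) :
    hcomp (vcomp (pinj1 U) (hid K)) (iterplus a f g)
    =c hcomp (vcomp a (iterplus a f g)) g
| ceq_iterplus_uniq U V K W A B (a : cell U A A V) (f : cell K A B W)
    (g : cell (eten V W) un un W) (h : cell (eten (eplus U) K) A B W) :
    hcomp (vcomp (pinj0 U) (hid K)) h =c f ->
    hcomp (vcomp (pinj1 U) (hid K)) h =c hcomp (vcomp a h) g ->
    h =c iterplus a f g
where "a =c b" := (ceq a b).

Definition cmul U W A (a : cell U A A W) : cell (emul U) A A (emul W) :=
  conv (ee_refl _) erefl erefl (ee_tene1 _)
    (itermul a
      (conv (ee_refl _) (ten1o A) (ten1o A) (ee_refl _)
        (hcomp (mprj0 U) (vid A)))
      (mprj1 U)).

Definition cplus U W A (a : cell U A A W) : cell (eplus U) A A (eplus W) :=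
  conv (ee_tene1 _) erefl erefl (ee_refl _)
    (iterplus a
      (conv (ee_refl _) (teno1 A) (teno1 A) (ee_refl _)
        (hcomp (vid A) (pinj0 W)))
      (pinj1 W)).

Lemma ee_ten11e U : eten (eten eun eun) U =e U.
Proof. exact: ee_trans (ee_ten (ee_ten1e _) (ee_refl _)) (ee_ten1e _). Qed.

Lemma ee_tene11 U : eten (eten U eun) eun =e U.
Proof. exact: ee_trans (ee_tene1 _) (ee_tene1 _). Qed.

Fixpoint chi (U : exch C) (B : C) : cell U B B U :=
  match U return cell U B B U with
  | eout A =>
      conv (ee_tene11 _) (ten1o B) (teno1 B) (ee_ten11e _)
        (vcomp (vcomp (hcomp (getL A) (vid B))
                      (crn (braid A B)))
               (hcomp (vid B) (putR A)))
  | ein A =>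
      conv (ee_ten11e _) (teno1 B) (ten1o B) (ee_tene11 _)
        (vcomp (vcomp (hcomp (vid B) (getR A))
                      (crn (braid B A)))
               (hcomp (putL A) (vid B)))
  | eun => vid B
  | eten U W => vcomp (chi U B) (chi W B)
  | esum U W =>
      conv (ee_refl _) (teno1 B) (teno1 B) (ee_refl _)
        (casec (hcomp (chi U B) (inj0 U W)) (hcomp (chi W B) (inj1 U W)))
  | eprod U W =>
      conv (ee_refl _) (ten1o B) (ten1o B) (ee_refl _)
        (pairc (hcomp (prj0 U W) (chi U B)) (hcomp (prj1 U W) (chi W B)))
  | emul U => cmul (chi U B)
  | eplus U => cplus (chi U B)
  end.

Lemma ceq_bound U A B W U' A' B' W' (a : cell U A B W) (b : cell U' A' B' W') :
  a =c b -> [/\ U =e U', A = A', B = B' & W =e W'].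
Proof.
elim=> {U A B W U' A' B' W' a b}; intros;
 repeat match goal with H : and4 _ _ _ _ |- _ => destruct H end;
 split; subst;
 try congruence; try apply: ee_refl; try (by apply: ee_sym);
 try (by apply: ee_trans; eassumption);
 eauto using exch_eq, tenA, ten1o, teno1, eq_sym.
all: by rewrite ?ten1o ?teno1.
Qed.

Lemma ceq_convV U U' A A' B B' W W' (eU : U =e U') (eA : A = A') (eB : B = B')
    (eW : W =e W') (a : cell U A B W) : a =c conv eU eA eB eW a.
Proof. exact: ceq_sym (ceq_conv _ _ _ _ _). Qed.

Lemma ceq_vpad (P Q : exch C) (h : cell P un un Q) : h =c vcomp h (hid eun).
Proof.
apply: ceq_trans (ceq_sym (ceq_vcompc1 _)) _.
exact: ceq_vcomp (ceq_refl _) (ceq_sym ceq_hid_un).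
Qed.

Lemma chi_mprj0 U B :
  hcomp (chi (emul U) B) (mprj0 U) =c hcomp (mprj0 U) (vid B).
Proof.
apply: ceq_trans (ceq_hcomp (ceq_conv _ _ _ _ _) (ceq_vpad _)) _.
exact: ceq_trans (ceq_itermul0 _ _ _) (ceq_conv _ _ _ _ _).
Qed.

Lemma chi_mprj1 U B :
  hcomp (chi (emul U) B) (mprj1 U)
  =c hcomp (mprj1 U) (vcomp (chi U B) (chi (emul U) B)).
Proof.
apply: ceq_trans (ceq_hcomp (ceq_conv _ _ _ _ _) (ceq_vpad _)) _.
apply: ceq_trans (ceq_itermul1 _ _ _) _.
exact: (ceq_hcomp (ceq_refl _) (ceq_vcomp (ceq_refl _) (ceq_convV _ _ _ _ _))).
Qed.

Lemma chi_pinj0 U B :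
  hcomp (pinj0 U) (chi (eplus U) B) =c hcomp (vid B) (pinj0 U).
Proof.
apply: ceq_trans (ceq_hcomp (ceq_vpad _) (ceq_conv _ _ _ _ _)) _.
exact: ceq_trans (ceq_iterplus0 _ _ _) (ceq_conv _ _ _ _ _).
Qed.

Lemma chi_pinj1 U B :
  hcomp (pinj1 U) (chi (eplus U) B)
  =c hcomp (vcomp (chi U B) (chi (eplus U) B)) (pinj1 U).
Proof.
apply: ceq_trans (ceq_hcomp (ceq_vpad _) (ceq_conv _ _ _ _ _)) _.
apply: ceq_trans (ceq_iterplus1 _ _ _) _.
exact: (ceq_hcomp (ceq_vcomp (ceq_refl _) (ceq_convV _ _ _ _ _)) (ceq_refl _)).
Qed.

Lemma mprj0_eq U U' : U =e U' -> mprj0 U =c mprj0 U'.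
Proof.
move=> e; apply: ceq_trans (ceq_conv _ _ _ _ _) (ceq_trans _ (ceq_convV _ _ _ _ _)).
by apply: ceq_prj0; [apply: ee_refl|apply: ee_ten => //; apply: ee_mul].
Qed.

Lemma mprj1_eq U U' : U =e U' -> mprj1 U =c mprj1 U'.
Proof.
move=> e; apply: ceq_trans (ceq_conv _ _ _ _ _) (ceq_trans _ (ceq_convV _ _ _ _ _)).
by apply: ceq_prj1; [apply: ee_refl|apply: ee_ten => //; apply: ee_mul].
Qed.

Lemma pinj0_eq U U' : U =e U' -> pinj0 U =c pinj0 U'.
Proof.
move=> e; apply: ceq_trans (ceq_conv _ _ _ _ _) (ceq_trans _ (ceq_convV _ _ _ _ _)).
by apply: ceq_inj0; [apply: ee_refl|apply: ee_ten => //; apply: ee_plus].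
Qed.

Lemma pinj1_eq U U' : U =e U' -> pinj1 U =c pinj1 U'.
Proof.
move=> e; apply: ceq_trans (ceq_conv _ _ _ _ _) (ceq_trans _ (ceq_convV _ _ _ _ _)).
by apply: ceq_inj1; [apply: ee_refl|apply: ee_ten => //; apply: ee_plus].
Qed.

(* [chi] is defined by recursion on expressions; this lemma makes it well
   defined on the monoid of exchanges. *)
Lemma chi_exch_eq U U' B : U =e U' -> chi U B =c chi U' B.
Proof.
elim=> {U U'} [U|U W _ IH|U V W _ I1 _ I2
  |U U' W W' _ IU _ IW|U U' W W' eU IU eW IW
  |U U' W W' eU IU eW IW|U U' eU IU|U U' eU IU|U V W|U|U|U|U].
- exact: ceq_refl.
- exact: ceq_sym.
- exact: ceq_trans I1 I2.
- exact: ceq_vcomp.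
- apply: ceq_trans (ceq_conv _ _ _ _ _) (ceq_trans _ (ceq_convV _ _ _ _ _)).
  by apply: ceq_pairc; apply: ceq_hcomp => //; [apply: ceq_prj0|apply: ceq_prj1].
- apply: ceq_trans (ceq_conv _ _ _ _ _) (ceq_trans _ (ceq_convV _ _ _ _ _)).
  by apply: ceq_casec; apply: ceq_hcomp => //; [apply: ceq_inj0|apply: ceq_inj1].
- apply: ceq_trans (ceq_conv _ _ _ _ _) (ceq_trans _ (ceq_convV _ _ _ _ _)).
  apply: ceq_itermul => //; last exact: mprj1_eq.
  apply: ceq_trans (ceq_conv _ _ _ _ _) (ceq_trans _ (ceq_convV _ _ _ _ _)).
  exact: ceq_hcomp (mprj0_eq eU) (ceq_refl _).
- apply: ceq_trans (ceq_conv _ _ _ _ _) (ceq_trans _ (ceq_convV _ _ _ _ _)).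
  apply: ceq_iterplus => //; last exact: pinj1_eq.
  apply: ceq_trans (ceq_conv _ _ _ _ _) (ceq_trans _ (ceq_convV _ _ _ _ _)).
  exact: ceq_hcomp (ceq_refl _) (pinj0_eq eU).
- exact: ceq_vcompA.
- exact: ceq_vcomp1c.
- exact: ceq_vcompc1.
- apply: ceq_trans (ceq_convV (ee_mul_unfold U) erefl erefl
    (ee_mul_unfold U) _) _.
  apply: ceq_trans (ceq_convV _ _ _ _ _).
  have E0 : prj0 eun (eten U (emul U)) =c mprj0 U by exact: ceq_convV.
  have E1 : prj1 eun (eten U (emul U)) =c mprj1 U by exact: ceq_convV.
  have H := @ceq_pairc_uniq _ _ _ _ _
    (conv (ee_refl _) (ten1o _) (ten1o _) (ee_refl _)
      (hcomp (prj0 eun (eten U (emul U))) (vid B)))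
    (conv (ee_refl _) (ten1o _) (ten1o _) (ee_refl _)
      (hcomp (prj1 eun (eten U (emul U))) (vcomp (chi U B) (chi (emul U) B)))).
  apply: ceq_trans (H _ _ _) _.
  + apply: ceq_trans (ceq_hcomp (ceq_conv _ _ _ _ _) E0) _.
    apply: ceq_trans (chi_mprj0 _ _) (ceq_trans _ (ceq_convV _ _ _ _ _)).
    exact: ceq_hcomp (ceq_sym E0) (ceq_refl _).
  + apply: ceq_trans (ceq_hcomp (ceq_conv _ _ _ _ _) E1) _.
    apply: ceq_trans (chi_mprj1 _ _) (ceq_trans _ (ceq_convV _ _ _ _ _)).
    exact: ceq_hcomp (ceq_sym E1) (ceq_refl _).
  + apply: ceq_pairc; exact: ceq_conv.
- apply: ceq_trans (ceq_convV (ee_plus_unfold U) erefl erefl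
    (ee_plus_unfold U) _) _.
  apply: ceq_trans (ceq_convV _ _ _ _ _).
  have E0 : inj0 eun (eten U (eplus U)) =c pinj0 U by exact: ceq_convV.
  have E1 : inj1 eun (eten U (eplus U)) =c pinj1 U by exact: ceq_convV.
  have H := @ceq_casec_uniq _ _ _ _ _
    (conv (ee_refl _) (teno1 _) (teno1 _) (ee_refl _)
      (hcomp (vid B) (inj0 eun (eten U (eplus U)))))
    (conv (ee_refl _) (teno1 _) (teno1 _) (ee_refl _)
      (hcomp (vcomp (chi U B) (chi (eplus U) B)) (inj1 eun (eten U (eplus U))))).
  apply: ceq_trans (H _ _ _) _.
  + apply: ceq_trans (ceq_hcomp E0 (ceq_conv _ _ _ _ _)) _.
    apply: ceq_trans (chi_pinj0 _ _) (ceq_trans _ (ceq_convV _ _ _ _ _)).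
    exact: ceq_hcomp (ceq_refl _) (ceq_sym E0).
  + apply: ceq_trans (ceq_hcomp E1 (ceq_conv _ _ _ _ _)) _.
    apply: ceq_trans (chi_pinj1 _ _) (ceq_trans _ (ceq_convV _ _ _ _ _)).
    exact: ceq_hcomp (ceq_refl _) (ceq_sym E1).
  + apply: ceq_casec; exact: ceq_conv.
Qed.

End Cells.

Notation "a =c b" := (ceq a b) (at level 70, no associativity).

(* Main.v *)
(* The claim is the instance [f = sig0], [f = sig1] of the naturality of [chi U]
   along every arrow [f : A -> B], namely f / chi_{U,B} = chi_{U,A} / f, which
   goes by induction on U.  On A° and A• it is naturality of the braiding.
   A cell with trivial top and bottom slides freely past [f], so for products
   and sums both sides have the same composites with the projections or the
   injections, and for U^× and U^+ both sides solve the same recursion, whose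
   step is chi_{U,A}. *)
From mathcomp Require Import ssreflect ssrfun ssrbool.
Require Import Defs.

Set Implicit Arguments.
Unset Strict Implicit.
Unset Printing Implicit Defensive.

Section Naturality.
Variable C : distmoncat.
Implicit Types (U V W X : exch C) (A B D P : C).

(* In these composites a trivial boundary is absorbed, so that equations
   between them can be chained without re-indexing. *)

Definition vpre V W A B D (f : cell eun A D eun) (c : cell V D B W) :
    cell V A B W :=
  conv (ee_ten1e _) erefl erefl (ee_ten1e _) (vcomp f c).

Definition vpost V W A B D (c : cell V A D W) (f : cell eun D B eun) :
    cell V A B W :=
  conv (ee_tene1 _) erefl erefl (ee_tene1 _) (vcomp c f).

Definition hpre V U W A B (p : cell V un un U) (c : cell U A B W) :
    cell V A B W :=
  conv (ee_refl _) (ten1o A) (ten1o B) (ee_refl _) (hcomp p c).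

Definition hpost V U W A B (c : cell V A B U) (p : cell U un un W) :
    cell V A B W :=
  conv (ee_refl _) (teno1 A) (teno1 B) (ee_refl _) (hcomp c p).

Lemma vpreE V W A B D (f : cell eun A D eun) (c : cell V D B W) :
  vpre f c =c vcomp f c.
Proof. exact: ceq_conv. Qed.

Lemma vpostE V W A B D (c : cell V A D W) (f : cell eun D B eun) :
  vpost c f =c vcomp c f.
Proof. exact: ceq_conv. Qed.

Lemma hpreE V U W A B (p : cell V un un U) (c : cell U A B W) :
  hpre p c =c hcomp p c.
Proof. exact: ceq_conv. Qed.

Lemma hpostE V U W A B (c : cell V A B U) (p : cell U un un W) :
  hpost c p =c hcomp c p.
Proof. exact: ceq_conv. Qed.

Lemma ceq_conv2 U1 V1 A1 A1' B1 B1' W1 X1 U2 V2 A2 A2' B2 B2' W2 X2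
    (eU1 : U1 =e V1) (eA1 : A1 = A1') (eB1 : B1 = B1') (eW1 : W1 =e X1)
    (eU2 : U2 =e V2) (eA2 : A2 = A2') (eB2 : B2 = B2') (eW2 : W2 =e X2)
    (a : cell U1 A1 B1 W1) (b : cell U2 A2 B2 W2) :
  a =c b -> conv eU1 eA1 eB1 eW1 a =c conv eU2 eA2 eB2 eW2 b.
Proof.
by move=> e; apply: ceq_trans (ceq_trans (ceq_conv _ _ _ _ _) e) (ceq_convV _ _ _ _ _).
Qed.

(** * Pasting and interchange *)

(** Stacked squares: by associativity the middle arrow [g] leaves the first equation and enters the
    second. This is the tensor case of naturality, and it also joins the three layers of the
    crossing cells at [eout] and [ein]. *)
Lemma vcomp_paste U U' V V' W W' X X' A B D A' B' D'
    (f : cell eun A A' eun) (g : cell eun B B' eun) (h : cell eun D D' eun)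
    (c : cell U A' B' V) (d : cell W B' D' X)
    (c' : cell U' A B V') (d' : cell W' B D X') :
  vcomp f c =c vcomp c' g -> vcomp g d =c vcomp d' h ->
  vcomp f (vcomp c d) =c vcomp (vcomp c' d') h.
Proof.
move=> e1 e2; apply: ceq_trans (ceq_sym (ceq_vcompA _ _ _)) _.
apply: ceq_trans (ceq_vcomp e1 (ceq_refl _)) _.
apply: ceq_trans (ceq_vcompA _ _ _) _.
apply: ceq_trans (ceq_vcomp (ceq_refl _) e2) _.
exact: ceq_sym (ceq_vcompA _ _ _).
Qed.

(** Interchange lets two-layer composites be compared column by column; the layers containing
    [getL], [putR], [getR] and [putL] are treated this way. *)
Lemma interchange_eq U1 V1 W1 U1' V1' W1' U2 V2 W2 U2' V2' W2'
    A1 B1 D1 A1' B1' D1' A2 B2 D2 A2' B2' D2'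
    (a1 : cell U1 A1 D1 V1) (b1 : cell U1' D1 B1 V1')
    (c1 : cell V1 A1' D1' W1) (d1 : cell V1' D1' B1' W1')
    (a2 : cell U2 A2 D2 V2) (b2 : cell U2' D2 B2 V2')
    (c2 : cell V2 A2' D2' W2) (d2 : cell V2' D2' B2' W2') :
  vcomp a1 b1 =c vcomp a2 b2 -> vcomp c1 d1 =c vcomp c2 d2 ->
  vcomp (hcomp a1 c1) (hcomp b1 d1) =c vcomp (hcomp a2 c2) (hcomp b2 d2).
Proof.
move=> e1 e2; apply: ceq_trans (ceq_sym (ceq_interchange _ _ _ _)) _.
by apply: ceq_trans (ceq_hcomp e1 e2) (ceq_interchange _ _ _ _).
Qed.

Lemma vcomp_vidC U W A B (a : cell U A B W) :
  vcomp (vid A) a =c vcomp a (vid B).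
Proof. exact: ceq_trans (ceq_vcomp1c _) (ceq_sym (ceq_vcompc1 _)). Qed.

Lemma ceq_hid_vcomp U W B (a : cell U un B W) : vcomp (hid eun) a =c a.
Proof.
exact: ceq_trans (ceq_vcomp (ceq_hid_un _) (ceq_refl _)) (ceq_vcomp1c _).
Qed.

Lemma ceq_vcomp_hid U W A (a : cell U A un W) : vcomp a (hid eun) =c a.
Proof.
exact: ceq_trans (ceq_vcomp (ceq_refl _) (ceq_hid_un _)) (ceq_vcompc1 _).
Qed.

(** * Sliding arrows past cells with trivial top and bottom *)

(** Since id_I = 1_I, [p] can be padded above with [hid eun]; interchange puts [f] beside the
    padding, which then disappears. The three variants that follow pad [p] on the side, above or
    below, where [f] stands. *)
Lemma vpre_hpost V U W A B D (f : cell eun A D eun) (c : cell V D B U)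
    (p : cell U un un W) : hpost (vpre f c) p =c vpre f (hpost c p).
Proof.
apply: ceq_conv2.
apply: ceq_trans (ceq_hcomp (ceq_conv _ _ _ _ _) (ceq_sym (ceq_hid_vcomp p))) _.
apply: ceq_trans (ceq_interchange _ _ _ _) _.
exact: ceq_vcomp (ceq_hcompc1 _) (ceq_sym (hpostE _ _)).
Qed.

Lemma vpost_hpost V U W A B D (c : cell V A D U) (f : cell eun D B eun)
    (p : cell U un un W) : hpost (vpost c f) p =c vpost (hpost c p) f.
Proof.
apply: ceq_conv2.
apply: ceq_trans (ceq_hcomp (ceq_conv _ _ _ _ _) (ceq_sym (ceq_vcomp_hid p))) _.
apply: ceq_trans (ceq_interchange _ _ _ _) _.
exact: ceq_vcomp (ceq_convV _ _ _ _ _) (ceq_hcompc1 _).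
Qed.

Lemma vpre_hpre V U W A B D (f : cell eun A D eun) (p : cell V un un U)
    (c : cell U D B W) : hpre p (vpre f c) =c vpre f (hpre p c).
Proof.
apply: ceq_conv2.
apply: ceq_trans (ceq_hcomp (ceq_sym (ceq_hid_vcomp p)) (ceq_conv _ _ _ _ _)) _.
apply: ceq_trans (ceq_interchange _ _ _ _) _.
exact: ceq_vcomp (ceq_hcomp1c _) (ceq_convV _ _ _ _ _).
Qed.

Lemma vpost_hpre V U W A B D (p : cell V un un U) (c : cell U A D W)
    (f : cell eun D B eun) : hpre p (vpost c f) =c vpost (hpre p c) f.
Proof.
apply: ceq_conv2.
apply: ceq_trans (ceq_hcomp (ceq_sym (ceq_vcomp_hid p)) (ceq_conv _ _ _ _ _)) _.
apply: ceq_trans (ceq_interchange _ _ _ _) _.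
exact: ceq_vcomp (ceq_convV _ _ _ _ _) (ceq_hcomp1c _).
Qed.

(** * Uniqueness principles for products, sums and iterations *)

(** Joint monicity of the projections: [h] and [k] are both the pairing of the two projections of
    [k]. *)
Lemma prod_ext V U W A B (h k : cell V A B (eprod U W)) :
  hpost h (prj0 U W) =c hpost k (prj0 U W) ->
  hpost h (prj1 U W) =c hpost k (prj1 U W) -> h =c k.
Proof.
move=> e0 e1; have L (l : cell V A B (eprod U W)) :
    hpost l (prj0 U W) =c hpost k (prj0 U W) ->
    hpost l (prj1 U W) =c hpost k (prj1 U W) ->
    l =c pairc (hpost k (prj0 U W)) (hpost k (prj1 U W)).
  by move=> l0 l1; apply: ceq_pairc_uniq;
    [apply: ceq_trans (ceq_sym (hpostE _ _)) l0|apply: ceq_trans (ceq_sym (hpostE _ _)) l1].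
by apply: ceq_trans (L h e0 e1) (ceq_sym (L k (ceq_refl _) (ceq_refl _))).
Qed.

Lemma sum_ext U W V A B (h k : cell (esum U W) A B V) :
  hpre (inj0 U W) h =c hpre (inj0 U W) k ->
  hpre (inj1 U W) h =c hpre (inj1 U W) k -> h =c k.
Proof.
move=> e0 e1; have L (l : cell (esum U W) A B V) :
    hpre (inj0 U W) l =c hpre (inj0 U W) k ->
    hpre (inj1 U W) l =c hpre (inj1 U W) k ->
    l =c casec (hpre (inj0 U W) k) (hpre (inj1 U W) k).
  by move=> l0 l1; apply: ceq_casec_uniq;
    [apply: ceq_trans (ceq_sym (hpreE _ _)) l0|apply: ceq_trans (ceq_sym (hpreE _ _)) l1].
by apply: ceq_trans (L h e0 e1) (ceq_sym (L k (ceq_refl _) (ceq_refl _))).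
Qed.

(** The universal property of [itermul] at K = I, with the factor I absorbed: two solutions of one
    recursion both equal [itermul a f g]. *)
Lemma mul_uniq V U W A B (a : cell V A A U) (f : cell W A B eun)
    (g : cell W un un (eten V W)) (h k : cell W A B (emul U)) :
  hpost h (mprj0 U) =c f -> hpost h (mprj1 U) =c hpre g (vcomp a h) ->
  hpost k (mprj0 U) =c f -> hpost k (mprj1 U) =c hpre g (vcomp a k) ->
  h =c k.
Proof.
have L (l : cell W A B (emul U)) :
    hpost l (mprj0 U) =c f -> hpost l (mprj1 U) =c hpre g (vcomp a l) ->
    l =c itermul a f g.
  (* The uniqueness clause concerns cells with right boundary [eten (emul U) K]; re-indexing gives
     [l] this form for K = I. *)
  pose l' := conv (ee_refl _) erefl erefl (ee_sym (ee_tene1 _)) l.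
  have l'E : l' =c l by apply: ceq_conv.
  move=> l0 l1; apply: ceq_trans (ceq_sym l'E) _; apply: ceq_itermul_uniq.
    apply: ceq_trans (ceq_hcomp l'E (ceq_vcomp_hid _)) _.
    exact: ceq_trans (ceq_sym (hpostE _ _)) l0.
  apply: ceq_trans (ceq_hcomp l'E (ceq_vcomp_hid _)) _.
  apply: ceq_trans (ceq_trans (ceq_sym (hpostE _ _)) l1) _.
  apply: ceq_trans (hpreE _ _) _.
  exact: ceq_hcomp (ceq_refl _) (ceq_vcomp (ceq_refl _) (ceq_sym l'E)).
by move=> h0 h1 k0 k1; apply: ceq_trans (L _ h0 h1) (ceq_sym (L _ k0 k1)).
Qed.

Lemma plus_uniq U V W A B (a : cell U A A V) (f : cell eun A B W)
    (g : cell (eten V W) un un W) (h k : cell (eplus U) A B W) :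
  hpre (pinj0 U) h =c f -> hpre (pinj1 U) h =c hpost (vcomp a h) g ->
  hpre (pinj0 U) k =c f -> hpre (pinj1 U) k =c hpost (vcomp a k) g ->
  h =c k.
Proof.
have L (l : cell (eplus U) A B W) :
    hpre (pinj0 U) l =c f -> hpre (pinj1 U) l =c hpost (vcomp a l) g ->
    l =c iterplus a f g.
  pose l' := conv (ee_sym (ee_tene1 _)) erefl erefl (ee_refl _) l.
  have l'E : l' =c l by apply: ceq_conv.
  move=> l0 l1; apply: ceq_trans (ceq_sym l'E) _; apply: ceq_iterplus_uniq.
    apply: ceq_trans (ceq_hcomp (ceq_vcomp_hid _) l'E) _.
    exact: ceq_trans (ceq_sym (hpreE _ _)) l0.
  apply: ceq_trans (ceq_hcomp (ceq_vcomp_hid _) l'E) _.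
  apply: ceq_trans (ceq_trans (ceq_sym (hpreE _ _)) l1) _.
  apply: ceq_trans (hpostE _ _) _.
  exact: ceq_hcomp (ceq_vcomp (ceq_refl _) (ceq_sym l'E)) (ceq_refl _).
by move=> h0 h1 k0 k1; apply: ceq_trans (L _ h0 h1) (ceq_sym (L _ k0 k1)).
Qed.

(** * Congruence, and the equations that characterise crossing cells *)

Lemma vpre_congr V W A B D (f : cell eun A D eun) (c d : cell V D B W) :
  c =c d -> vpre f c =c vpre f d.
Proof. by move=> e; apply: ceq_conv2; apply: ceq_vcomp (ceq_refl _) e. Qed.

Lemma vpost_congr V W A B D (c d : cell V A D W) (f : cell eun D B eun) :
  c =c d -> vpost c f =c vpost d f.
Proof. by move=> e; apply: ceq_conv2; apply: ceq_vcomp e (ceq_refl _). Qed.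

Lemma hpre_congr V U W A B (p : cell V un un U) (c d : cell U A B W) :
  c =c d -> hpre p c =c hpre p d.
Proof. by move=> e; apply: ceq_conv2; apply: ceq_hcomp (ceq_refl _) e. Qed.

Lemma hpost_congr V U W A B (c d : cell V A B U) (p : cell U un un W) :
  c =c d -> hpost c p =c hpost d p.
Proof. by move=> e; apply: ceq_conv2; apply: ceq_hcomp e (ceq_refl _). Qed.

Lemma chi_prj0 U W B :
  hpost (chi (eprod U W) B) (prj0 U W) =c hpre (prj0 U W) (chi U B).
Proof.
apply: ceq_conv2; apply: ceq_trans (ceq_hcomp (ceq_conv _ _ _ _ _) (ceq_refl _)) _.
exact: ceq_pairc0.
Qed.

Lemma chi_prj1 U W B :
  hpost (chi (eprod U W) B) (prj1 U W) =c hpre (prj1 U W) (chi W B).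
Proof.
apply: ceq_conv2; apply: ceq_trans (ceq_hcomp (ceq_conv _ _ _ _ _) (ceq_refl _)) _.
exact: ceq_pairc1.
Qed.

Lemma chi_inj0 U W B :
  hpre (inj0 U W) (chi (esum U W) B) =c hpost (chi U B) (inj0 U W).
Proof.
apply: ceq_conv2; apply: ceq_trans (ceq_hcomp (ceq_refl _) (ceq_conv _ _ _ _ _)) _.
exact: ceq_casec0.
Qed.

Lemma chi_inj1 U W B :
  hpre (inj1 U W) (chi (esum U W) B) =c hpost (chi W B) (inj1 U W).
Proof.
apply: ceq_conv2; apply: ceq_trans (ceq_hcomp (ceq_refl _) (ceq_conv _ _ _ _ _)) _.
exact: ceq_casec1.
Qed.

(** Carries an equation characterising a crossing cell over to its composite with [f]: sliding [f]
    past [p] exposes [hpost c p], and after the rewrite [f] slides back past [q]. *)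
Lemma vpre_hpost_eq V U W X A B D (f : cell eun A D eun) (c : cell V D B U)
    (p : cell U un un W) (q : cell V un un X) (d : cell X D B W) :
  hpost c p =c hpre q d -> hpost (vpre f c) p =c hpre q (vpre f d).
Proof.
move=> e; apply: ceq_trans (vpre_hpost _ _ _) _.
by apply: ceq_trans (vpre_congr f e) (ceq_sym (vpre_hpre _ _ _)).
Qed.

Lemma vpost_hpost_eq V U W X A B D (f : cell eun D B eun) (c : cell V A D U)
    (p : cell U un un W) (q : cell V un un X) (d : cell X A D W) :
  hpost c p =c hpre q d -> hpost (vpost c f) p =c hpre q (vpost d f).
Proof.
move=> e; apply: ceq_trans (vpost_hpost _ _ _) _.
by apply: ceq_trans (vpost_congr f e) (ceq_sym (vpost_hpre _ _ _)).
Qed.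

Lemma vpre_hpre_eq V U W X A B D (f : cell eun A D eun) (c : cell V D B U)
    (p : cell U un un W) (q : cell V un un X) (d : cell X D B W) :
  hpre q d =c hpost c p -> hpre q (vpre f d) =c hpost (vpre f c) p.
Proof. by move=> e; apply/ceq_sym/vpre_hpost_eq/ceq_sym. Qed.

Lemma vpost_hpre_eq V U W X A B D (f : cell eun D B eun) (c : cell V A D U)
    (p : cell U un un W) (q : cell V un un X) (d : cell X A D W) :
  hpre q d =c hpost c p -> hpre q (vpost d f) =c hpost (vpost c f) p.
Proof. by move=> e; apply/ceq_sym/vpost_hpost_eq/ceq_sym. Qed.

(** * Naturality of the crossing cells *)

Lemma vid_ten_crn P A B (f : hom A B) :
  hcomp (vid P) (crn f) =c crn (tenm (idm P) f).
Proof.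
apply: ceq_trans (ceq_sym (ceq_crn_ten _ _)).
exact: ceq_hcomp (ceq_sym (ceq_crn_id _)) (ceq_refl _).
Qed.

Lemma crn_ten_vid P A B (f : hom A B) :
  hcomp (crn f) (vid P) =c crn (tenm f (idm P)).
Proof.
apply: ceq_trans (ceq_sym (ceq_crn_ten _ _)).
exact: ceq_hcomp (ceq_refl _) (ceq_sym (ceq_crn_id _)).
Qed.

(** The two sides of a naturality square have boundaries [eten eun V] and [eten V eun]; only after
    re-indexing do they share a type, as the uniqueness principles require. *)
Lemma vcomp_of_vpre V W A B D E (f : cell eun A D eun) (c : cell V D B W)
    (d : cell V A E W) (g : cell eun E B eun) :
  vpre f c =c vpost d g -> vcomp f c =c vcomp d g.
Proof.
by move=> e; apply: ceq_trans (ceq_sym (vpreE _ _)) (ceq_trans e (vpostE _ _)).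
Qed.

Lemma vpre_vpost V W A B D E (f : cell eun A D eun) (c : cell V D B W)
    (d : cell V A E W) (g : cell eun E B eun) :
  vcomp f c =c vcomp d g -> vpre f c =c vpost d g.
Proof. exact: ceq_conv2. Qed.

(** One turn of an iteration: [f] is pushed through the step [c], which becomes [c'], and then
    stands above the next iterate [d]. *)
Lemma vcomp_step U U' V V' W X A A' B B' D
    (f : cell eun A A' eun) (g : cell eun B B' eun)
    (c : cell U A' B' V) (c' : cell U' A B V') (d : cell W B' D X) :
  vcomp f c =c vcomp c' g -> vcomp f (vcomp c d) =c vcomp c' (vpre g d).
Proof.
move=> e; apply: ceq_trans (ceq_sym (ceq_vcompA _ _ _)) _.
apply: ceq_trans (ceq_vcomp e (ceq_refl _)) _.
apply: ceq_trans (ceq_vcompA _ _ _) _.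
exact: ceq_vcomp (ceq_refl _) (ceq_convV _ _ _ _ _).
Qed.

Lemma vpost_vcomp U V W X A B D E (c : cell U A B V) (d : cell W B D X)
    (f : cell eun D E eun) : vpost (vcomp c d) f =c vcomp c (vpost d f).
Proof.
apply: ceq_trans (vpostE _ _) (ceq_trans (ceq_vcompA _ _ _) _).
exact: ceq_vcomp (ceq_refl _) (ceq_convV _ _ _ _ _).
Qed.

(** The arrow [f] passes to the right of [getL], is carried to the left by the braiding, and leaves
    beside [putR]. *)
Lemma chi_nat_out P A B (f : hom A B) :
  vcomp (crn f) (chi (eout P) B) =c vcomp (chi (eout P) A) (crn f).
Proof.
(* Units are placed beside [f]: on the left above [getL], and on the right below [putR], so that
   every layer has two columns. *)
apply: ceq_trans (ceq_vcomp (ceq_sym (ceq_hcomp1c _)) (ceq_conv _ _ _ _ _)) _.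
apply: ceq_trans (ceq_vcomp (ceq_convV _ _ _ _ _) (ceq_hcompc1 _)).
apply: (vcomp_paste (g := hcomp (crn f) (vid P))).
  apply: (vcomp_paste (g := hcomp (vid P) (crn f))).
    apply: interchange_eq; last exact: ceq_sym (vcomp_vidC _).
    exact: ceq_trans (ceq_hid_vcomp _) (ceq_sym (ceq_vcompc1 _)).
  apply: ceq_trans (ceq_vcomp (vid_ten_crn _ _) (ceq_refl _)) _.
  apply: ceq_trans (ceq_vcomp (ceq_refl _) (ceq_sym (crn_ten_vid _ _))).
  (* Both sides now come from composites in the base category, where naturality of the braiding
     applies. *)
  apply: ceq_trans (ceq_sym (ceq_crn_comp _ _)) _; rewrite braid_nat.
  exact: ceq_crn_comp.
apply: interchange_eq; first exact: ceq_sym (vcomp_vidC _).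
exact: ceq_trans (ceq_vcomp1c _) (ceq_sym (ceq_vcomp_hid _)).
Qed.

(** Mirror image of the previous case: [getR] stands on the right, so the braiding carries [f] from
    left to right. *)
Lemma chi_nat_in P A B (f : hom A B) :
  vcomp (crn f) (chi (ein P) B) =c vcomp (chi (ein P) A) (crn f).
Proof.
apply: ceq_trans (ceq_vcomp (ceq_sym (ceq_hcompc1 _)) (ceq_conv _ _ _ _ _)) _.
apply: ceq_trans (ceq_vcomp (ceq_convV _ _ _ _ _) (ceq_hcomp1c _)).
apply: (vcomp_paste (g := hcomp (vid P) (crn f))).
  apply: (vcomp_paste (g := hcomp (crn f) (vid P))).
    apply: interchange_eq; first exact: ceq_sym (vcomp_vidC _).
    exact: ceq_trans (ceq_hid_vcomp _) (ceq_sym (ceq_vcompc1 _)).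
  apply: ceq_trans (ceq_vcomp (crn_ten_vid _ _) (ceq_refl _)) _.
  apply: ceq_trans (ceq_vcomp (ceq_refl _) (ceq_sym (vid_ten_crn _ _))).
  apply: ceq_trans (ceq_sym (ceq_crn_comp _ _)) _; rewrite braid_nat.
  exact: ceq_crn_comp.
apply: interchange_eq; last exact: ceq_sym (vcomp_vidC _).
exact: ceq_trans (ceq_vcomp1c _) (ceq_sym (ceq_vcomp_hid _)).
Qed.

Lemma chi_nat U A B (f : hom A B) :
  vcomp (crn f) (chi U B) =c vcomp (chi U A) (crn f).
Proof.
elim: U => [X|X||U IU W IW|U IU W IW|U IU W IW|U IU|U IU].
- exact: chi_nat_out.
- exact: chi_nat_in.
- exact: ceq_sym (vcomp_vidC _).
- exact: vcomp_paste IU IW.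
- apply: vcomp_of_vpre; apply: prod_ext.
    apply: ceq_trans (vpre_hpost_eq _ (chi_prj0 U W B)) _.
    apply: ceq_trans (hpre_congr _ (vpre_vpost IU)) _.
    exact: ceq_sym (vpost_hpost_eq _ (chi_prj0 U W A)).
  apply: ceq_trans (vpre_hpost_eq _ (chi_prj1 U W B)) _.
  apply: ceq_trans (hpre_congr _ (vpre_vpost IW)) _.
  exact: ceq_sym (vpost_hpost_eq _ (chi_prj1 U W A)).
- apply: vcomp_of_vpre; apply: sum_ext.
    apply: ceq_trans (vpre_hpre_eq _ (chi_inj0 U W B)) _.
    apply: ceq_trans (hpost_congr _ (vpre_vpost IU)) _.
    exact: ceq_sym (vpost_hpre_eq _ (chi_inj0 U W A)).
  apply: ceq_trans (vpre_hpre_eq _ (chi_inj1 U W B)) _.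
  apply: ceq_trans (hpost_congr _ (vpre_vpost IW)) _.
  exact: ceq_sym (vpost_hpre_eq _ (chi_inj1 U W A)).
- apply: vcomp_of_vpre.
  (* An iteration loops on its top object, here [A], so the common step must be χ_{U,A}. The side
     with [f] on top starts with step χ_{U,B}, which the induction hypothesis exchanges through
     [vcomp_step]. *)
  apply: (mul_uniq (a := chi U A) (f := hpre (mprj0 U) (crn f)) (g := mprj1 U)).
  + apply: ceq_trans (vpre_hpost_eq _ (ceq_conv2 _ _ _ _ _ _ _ _ (chi_mprj0 U B))) _.
    by apply: hpre_congr; apply: ceq_trans (vpreE _ _) (ceq_vcompc1 _).
  + apply: ceq_trans (vpre_hpost_eq _ (ceq_conv2 _ _ _ _ _ _ _ _ (chi_mprj1 U B))) _.
    apply: hpre_congr; apply: ceq_trans (vpreE _ _) _.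
    exact: vcomp_step.
  + apply: ceq_trans (vpost_hpost_eq _ (ceq_conv2 _ _ _ _ _ _ _ _ (chi_mprj0 U A))) _.
    by apply: hpre_congr; apply: ceq_trans (vpostE _ _) (ceq_vcomp1c _).
  (* With [f] at the bottom the step is already χ_{U,A}, so associativity suffices. *)
  + apply: ceq_trans (vpost_hpost_eq _ (ceq_conv2 _ _ _ _ _ _ _ _ (chi_mprj1 U A))) _.
    apply: hpre_congr; exact: vpost_vcomp.
- apply: vcomp_of_vpre.
  apply: (plus_uniq (a := chi U A) (f := hpost (crn f) (pinj0 U)) (g := pinj1 U)).
  + apply: ceq_trans (vpre_hpre_eq _ (ceq_conv2 _ _ _ _ _ _ _ _ (chi_pinj0 U B))) _.
    by apply: hpost_congr; apply: ceq_trans (vpreE _ _) (ceq_vcompc1 _).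
  + apply: ceq_trans (vpre_hpre_eq _ (ceq_conv2 _ _ _ _ _ _ _ _ (chi_pinj1 U B))) _.
    apply: hpost_congr; apply: ceq_trans (vpreE _ _) _.
    exact: vcomp_step.
  + apply: ceq_trans (vpost_hpre_eq _ (ceq_conv2 _ _ _ _ _ _ _ _ (chi_pinj0 U A))) _.
    by apply: hpost_congr; apply: ceq_trans (vpostE _ _) (ceq_vcomp1c _).
  + apply: ceq_trans (vpost_hpre_eq _ (ceq_conv2 _ _ _ _ _ _ _ _ (chi_pinj1 U A))) _.
    apply: hpost_congr; exact: vpost_vcomp.
Qed.

End Naturality.

(** * Crossing a coproduct *)

Theorem lemma23 (C : distmoncat) (U : exch C) (A B : C) :
  (chi U (opl A B)
   =c copc (vcomp (chi U A) (crn (sig0 A B))) (vcomp (chi U B) (crn (sig1 A B))))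
  /\ (vcomp (crn (sig0 A B)) (chi U (opl A B))
      =c vcomp (chi U A) (crn (sig0 A B)))
  /\ (vcomp (crn (sig1 A B)) (chi U (opl A B))
      =c vcomp (chi U B) (crn (sig1 A B)))
  /\ (forall h : cell U (opl A B) (opl A B) U,
        vcomp (crn (sig0 A B)) h =c vcomp (chi U A) (crn (sig0 A B)) ->
        vcomp (crn (sig1 A B)) h =c vcomp (chi U B) (crn (sig1 A B)) ->
        h =c chi U (opl A B)).
Proof.
have E0 := chi_nat U (sig0 A B); have E1 := chi_nat U (sig1 A B).
(* The legs are re-indexed to side boundary [U], so that their copairing has the same type as
   [h]. *)
pose s0 := vpost (chi U A) (crn (sig0 A B)).
pose s1 := vpost (chi U B) (crn (sig1 A B)).
have S0 : s0 =c vcomp (chi U A) (crn (sig0 A B)) by apply: ceq_conv.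
have S1 : s1 =c vcomp (chi U B) (crn (sig1 A B)) by apply: ceq_conv.
(* Every solution, the crossing cell included, is this copairing; the formula and the uniqueness
   both follow. *)
have H (h : cell U (opl A B) (opl A B) U) :
    vcomp (crn (sig0 A B)) h =c vcomp (chi U A) (crn (sig0 A B)) ->
    vcomp (crn (sig1 A B)) h =c vcomp (chi U B) (crn (sig1 A B)) ->
    h =c copc s0 s1.
  by move=> h0 h1; apply: ceq_copc_uniq;
    [apply: ceq_trans h0 (ceq_sym S0)|apply: ceq_trans h1 (ceq_sym S1)].
split; first exact: ceq_trans (H _ E0 E1) (ceq_copc S0 S1).
split; first exact: E0.
split; first exact: E1.
by move=> h h0 h1; apply: ceq_trans (H h h0 h1) (ceq_sym (H _ E0 E1)).
Qed.
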